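(* Let $A$ be a set with $|A| = \aleph_0$, and let $C$ be a clone on $A$ with quasigroup operations. If $|\operatorname{Pol}\operatorname{Inv} C| \le \aleph_0$, then $C = \operatorname{Pol}\operatorname{Inv} C$.
   Context: A clone on $A$ is a set of finitary operations on $A$ containing all projections and closed under composition. For a clone $C$, $\operatorname{Inv} C$ is the set of all finitary relations on $A$ preserved by every function in $C$; for a set $R$ of finitary relations, $\operatorname{Pol} R$ is the set of all finitary operations on $A$ preserving every relation in $R$. ($\operatorname{Pol}\operatorname{Inv} C$ is the local closure of $C$: all finitary operations that can be interpolated on every finite subset of their domain by a function of $C$.) $C$ is a clone with quasigroup operations if there are binary operations $\cdot, \backslash, / \in C$ such that $(A; \cdot, \backslash, /)$ is a quasigroup, i.e. $x\backslash(x\cdot y)=y$, $x\cdot(x\backslash y)=y$, $(x\cdot y)/y = x$, $(x/y)\cdot y = x$ for all $x,y\in A$. *)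

(* Defs.v *)
From mathcomp Require Import all_boot.
From mathcomp Require Import boolp classical_sets functions cardinality.

Set Implicit Arguments.
Unset Strict Implicit.
Unset Printing Implicit Defensive.

Local Open Scope classical_set_scope.

(* A^n is represented by the function type 'I_n -> A. Arity 0 is allowed for
   both operations and relations; a clone may but need not contain nullary
   operations. *)
Definition op (A : Type) (n : nat) : Type := ('I_n -> A) -> A.
Definition finop (A : Type) : Type := {n : nat & op A n}.
Definition finrel (A : Type) : Type := {m : nat & set ('I_m -> A)}.

Definition mkop (A : Type) (n : nat) (f : op A n) : finop A :=
  existT (op A) n f.

Definition proj_op (A : Type) (n : nat) (i : 'I_n) : op A n := fun x => x i.

Definition comp_op (A : Type) (n k : nat) (f : op A n) (g : 'I_n -> op A k) :
  op A k := fun x => f (fun j => g j x).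

Definition binop (A : Type) (m : A -> A -> A) : op A 2 :=
  fun x => m (x ord0) (x ord_max).

Definition is_clone (A : Type) (C : set (finop A)) : Prop :=
  (forall (n : nat) (i : 'I_n), C (mkop (@proj_op A n i))) /\
  (forall (n k : nat) (f : op A n) (g : 'I_n -> op A k),
     C (mkop f) -> (forall j, C (mkop (g j))) -> C (mkop (comp_op f g))).

Definition is_quasigroup (A : Type) (mul ldiv rdiv : A -> A -> A) : Prop :=
  forall x y : A,
    [/\ ldiv x (mul x y) = y,
        mul x (ldiv x y) = y,
        rdiv (mul x y) y = x &
        mul (rdiv x y) y = x].

Definition is_clone_with_quasigroup_operations
    (A : Type) (C : set (finop A)) : Prop :=
  is_clone C /\
  exists mul ldiv rdiv : A -> A -> A,
    [/\ C (mkop (binop mul)), C (mkop (binop ldiv)), C (mkop (binop rdiv)) &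
        is_quasigroup mul ldiv rdiv].

(* M j is the j-th of the n argument tuples; f is applied coordinatewise. *)
Definition preserves (A : Type) (f : finop A) (r : finrel A) : Prop :=
  forall M : 'I_(projT1 f) -> 'I_(projT1 r) -> A,
    (forall j, projT2 r (M j)) ->
    projT2 r (fun i => projT2 f (fun j => M j i)).

Definition InvRel (A : Type) (C : set (finop A)) : set (finrel A) :=
  [set r | forall f, C f -> preserves f r].

Definition PolOp (A : Type) (R : set (finrel A)) : set (finop A) :=
  [set f | forall r, R r -> preserves f r].

(* Main.v *)
(** The [n]-ary part of [PolOp (InvRel C)] is the closure of the [n]-ary part
    of [C] in the topology of pointwise convergence on [A^(A^n)].  Being
    nonempty, countable and closed, it has an isolated point [g] by Baire's
    theorem.  For any other member [f], right multiplication by [g \ f] is an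
    injection of this closed set into itself, undone by right division, which
    sends [g] to [f]; hence [f] is isolated as well.  An isolated point of the
    closure of a set lies in that set. *)
Require Import Defs.
From mathcomp Require Import all_boot.
From mathcomp Require Import boolp classical_sets functions cardinality.

Local Open Scope classical_set_scope.
Local Open Scope card_scope.

(** For surjective [e], these are the basic neighbourhoods of [g] for pointwise convergence, with
    [B] discrete. *)
Definition agree {T B : Type} (e : nat -> T) (N : nat) (f g : T -> B) : Prop :=
  forall i, i < N -> f (e i) = g (e i).

Definition pointwise_closed {T B : Type} (e : nat -> T) (X : set (T -> B)) :
    Prop :=
  forall f, (forall N, exists2 g, X g & agree e N g f) -> X f.

Definition isolated_at {T B : Type} (e : nat -> T) (X : set (T -> B)) (N : nat)
    (g : T -> B) : Prop :=
  forall h, X h -> agree e N h g -> h = g.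

(* Baire's theorem for countable closed sets, by diagonalisation: without
   isolated points one builds a convergent sequence in [X] whose limit differs
   from each member of [X]. *)
Lemma countable_closed_isolated {T B : Type} (e : nat -> T) (X : set (T -> B)) :
  (forall x, exists i, e i = x) -> countable X -> pointwise_closed e X ->
  X !=set0 -> exists2 g, X g & exists N, isolated_at e X N g.
Proof.
move=> /choice[idx idxK] /countable_injP[c c_inj] Xclosed [g0 Xg0].
apply: contrapT => no_isolated.
have split_near g N : X g -> exists h, [/\ X h, agree e N h g & h <> g].
  move=> Xg; apply: contrapT => no_h; apply: no_isolated.
  exists g => //; exists N => h Xh hg.
  by apply: contrapT => h_neq; apply: no_h; exists h.
(* From [(k, (g, N))], stay within precision [N] of [g] but move away from the member of [X] with
   code [k], if there is one. *)
have step (a : nat * ((T -> B) * nat)) : exists b : (T -> B) * nat,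
    X a.2.1 -> [/\ X b.1, agree e a.2.2 b.1 a.2.1, a.2.2 < b.2 &
      forall h, X h -> c h = a.1 -> ~ agree e b.2 b.1 h].
  case: a => k [g N] /=.
  have [Xg|nXg] := pselect (X g); last by exists (g, N).
  have [[h [Xh hk]]|no_h] := pselect (exists h, X h /\ c h = k); last first.
    exists (g, N.+1) => _; split=> // h Xh hk.
    by case: no_h; exists h.
  have [g' [Xg' g'g g'h]] : exists g', [/\ X g', agree e N g' g & g' <> h].
    have [->|] := pselect (g = h); last by exists g.
    by apply: split_near.
  have [x g'hx] : exists x, g' x <> h x.
    apply: contrapT => g'h_eq; apply: g'h; apply/funext => x.
    by apply: contrapT => ?; apply: g'h_eq; exists x.
  (* [N.+1] makes the precision grow strictly; [(idx x).+1] puts [x], where [g'] and [h] differ,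
     among the points compared. *)
  exists (g', maxn N.+1 (idx x).+1) => _; split=> //=.
    by rewrite leq_maxl.
  move=> h' Xh' h'k /(_ (idx x)); rewrite leq_maxr idxK => /(_ isT).
  suff -> : h' = h by [].
  by apply: c_inj; rewrite ?inE // h'k.
have [next nextP] := choice step.
pose s := fix s k := if k is k'.+1 then next (k', s k') else (g0, 0).
have Xs k : X (s k).1.
  by elim: k => //= k IH; case: (nextP (k, s k) IH).
have s_step k := nextP (k, s k) (Xs k).
have le_s k : k <= (s k).2.
  elim: k => //= k IH; apply: leq_ltn_trans IH _.
  by case: (s_step k).
have s_mono k d : (s k).2 <= (s (k + d)).2.
  elim: d => [|d IH]; first by rewrite addn0.
  rewrite addnS; apply: leq_trans IH _.
  by case: (s_step (k + d)) => _ _ /ltnW.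
have s_agree k d : agree e (s k).2 (s (k + d)).1 (s k).1.
  elim: d => [|d IH]; first by rewrite addn0.
  move=> i ik; rewrite addnS -IH //.
  by case: (s_step (k + d)) => _ -> //; apply: leq_trans ik (s_mono k d).
(* From stage [(idx x).+1] on, the precision exceeds [idx x], so the value at [x] is final. *)
pose f x := (s (idx x).+1).1 x.
have s_lim k : agree e (s k).2 (s k).1 f.
  move=> i ik; rewrite /f; set j := (idx (e i)).+1.
  have := s_agree j k (idx (e i)) (le_s _); rewrite idxK => <-.
  by rewrite addnC s_agree.
have Xf : X f.
  apply: Xclosed => N; exists (s N).1 => // i iN; apply: s_lim.
  exact: leq_trans iN (le_s N).
(* Stage [c f] has separated the sequence from [f], its own limit. *)
by case: (s_step (c f)) => _ _ _ /(_ f Xf erefl); apply; apply: (s_lim (c f).+1).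
Qed.

Lemma PolInv_superset {A : Type} (C : set (finop A)) : C `<=` PolOp (InvRel C).
Proof. by move=> f Cf r; apply. Qed.

Lemma PolInv_comp {A : Type} (C : set (finop A)) (n k : nat) (f : op A n)
    (g : 'I_n -> op A k) :
  PolOp (InvRel C) (mkop f) -> (forall j, PolOp (InvRel C) (mkop (g j))) ->
  PolOp (InvRel C) (mkop (comp_op f g)).
Proof.
move=> Pf Pg r Cr M rM.
apply: (Pf r Cr (fun j i => g j (fun l => M l i))) => j.
exact: (Pg j r Cr M rM).
Qed.

Lemma PolInv_binop {A : Type} (C : set (finop A)) (m : A -> A -> A) (n : nat)
    (f g : op A n) :
  C (mkop (binop m)) ->
  PolOp (InvRel C) (mkop f) -> PolOp (InvRel C) (mkop g) ->
  PolOp (InvRel C) (mkop (fun x => m (f x) (g x))).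
Proof.
move=> /PolInv_superset Pm Pf Pg.
apply: (@PolInv_comp A C 2 n (binop m) (fun j => if j == ord0 then f else g)) => //.
by move=> j; case: ifP.
Qed.

(* The values on the rows of [M] of the [n]-ary members of [C] form an
   invariant relation, which contains the columns of [M]. *)
Lemma PolInv_interpolate {A : Type} (C : set (finop A)) (n m : nat) (f : op A n)
    (M : 'I_m -> 'I_n -> A) :
  is_clone C -> PolOp (InvRel C) (mkop f) ->
  exists2 g : op A n, C (mkop g) & forall i, g (M i) = f (M i).
Proof.
move=> [Cproj Ccomp] Pf.
pose r : finrel A := existT (fun m => set ('I_m -> A)) m
  [set t | exists2 g : op A n, C (mkop g) & forall i, g (M i) = t i].
have Cr : InvRel C r.
  move=> [k h] Ch M' /= rM'.
  have /choice[G GP] j : exists g : op A n,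
      C (mkop g) /\ forall i, g (M i) = M' j i.
    by have [g] := rM' j; exists g.
  exists (comp_op h G); first by apply: Ccomp => // j; case: (GP j).
  by move=> i; congr h; apply/funext => j; case: (GP j).
apply: (Pf r Cr (fun j i => M i j)) => j /=.
by exists (@proj_op A n j).
Qed.

Lemma PolInv_closed {A : Type} (C : set (finop A)) (n : nat)
    (e : nat -> 'I_n -> A) :
  (forall x, exists i, e i = x) ->
  pointwise_closed e [set f : op A n | PolOp (InvRel C) (mkop f)].
Proof.
move=> /choice[idx idxK] f f_lim r Cr M rM /=.
(* This precision covers all rows of [M], so [f] can be replaced by [g] on them. *)
have [g Pg gf] := f_lim (\max_i (idx (fun j => M j i)).+1).
have -> : (fun i => f (fun j => M j i)) = (fun i => g (fun j => M j i)).
  apply/funext => i; rewrite -[fun j => M j i]idxK gf //.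
  exact: (leq_bigmax i).
exact: (Pg r Cr M rM).
Qed.

Lemma countable_arity {A : Type} (P : set (finop A)) (n : nat) :
  countable P -> countable [set f : op A n | P (mkop f)].
Proof.
move=> /countable_injP[c c_inj]; apply/countable_injP.
exists (fun f => c (mkop f)) => f g; rewrite !inE => Pf Pg fg.
by apply: (@eq_from_Tagged nat (op A)); apply: c_inj; rewrite ?inE.
Qed.

Lemma enumerate_tuples (A : Type) (n : nat) :
  countable [set: A] -> [set: A] !=set0 ->
  exists e : nat -> 'I_n -> A, forall x, exists i, e i = x.
Proof.
move=> /countable_injP[c c_inj] [a _].
have /choice[d dK] k : exists b, forall x, c x = k -> b = x.
  have [[b bk]|no_b] := pselect (exists b, c b = k).
    by exists b => x xk; apply: c_inj; rewrite ?inE // bk.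
  by exists a => x xk; case: no_b; exists x.
(* Tuples are coded through finite functions into [nat]; numbers coding nothing yield the constant
   tuple [a]. *)
exists (fun k i => if unpickle k is Some t then d ((t : {ffun 'I_n -> nat}) i)
                   else a) => x.
exists (pickle [ffun i => c (x i)]); apply/funext => i.
by rewrite pickleK ffunE; apply: dK.
Qed.

(** Interpolating [f] at the first [N] points of [e] gives a member of [C] that isolation forces to
    equal [f]. *)
Lemma PolInv_isolated_mem {A : Type} (C : set (finop A)) (n : nat)
    (e : nat -> 'I_n -> A) (N : nat) (f : op A n) :
  is_clone C -> PolOp (InvRel C) (mkop f) ->
  isolated_at e [set g : op A n | PolOp (InvRel C) (mkop g)] N f ->
  C (mkop f).
Proof.
move=> Cclone Pf f_iso.
have [g Cg gf] := PolInv_interpolate C n N f (fun i => e i) Cclone Pf.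
rewrite -(f_iso g) //; first exact: PolInv_superset.
by move=> i iN; apply: (gf (Ordinal iN)).
Qed.

Theorem theorem1p1 (A : Type) (C : set (finop A)) :
  [set: A] #= [set: nat] ->
  is_clone_with_quasigroup_operations C ->
  countable (PolOp (InvRel C)) ->
  C = PolOp (InvRel C).
Proof.
move=> A_nat [Cclone [mul [ldiv [rdiv [Cmul Cldiv Crdiv qg]]]]] Pcount.
have A_count : countable [set: A] by rewrite (eq_countable A_nat).
apply/seteqP; split=> [|[n f] Pf]; first exact: PolInv_superset.
have A_ne : [set: A] !=set0.
  apply/set0P/eqP => A0; move: A_nat; rewrite A0 card_eq_sym card_eq0 => /eqP.
  by apply/eqP/set0P; exists 0.
have [e e_surj] := enumerate_tuples A n A_count A_ne.
have [|g Pg [N g_iso]] := countable_closed_isolated e _ e_surj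
  (countable_arity _ n Pcount) (PolInv_closed C n e e_surj).
  by exists f.
have Pq := PolInv_binop C ldiv n g f Cldiv Pg Pf.
apply: (@PolInv_isolated_mem A C n e N) => // h Ph hf.
(* With [q = g \ f], [h / q] agrees with [f / q = g] up to [N], hence equals [g]; multiplying back
   by [q] gives [h = g q = f]. The same [N] thus isolates [f]. *)
have /(congr1 (fun k x => mul (k x) (ldiv (g x) (f x)))) :
    (fun x => rdiv (h x) (ldiv (g x) (f x))) = g.
  apply: g_iso; first exact: PolInv_binop.
  move=> i /hf ->; have [_ gf _ _] := qg (g (e i)) (f (e i)).
  by rewrite -{1}gf; have [_ _ -> _] := qg (g (e i)) (ldiv (g (e i)) (f (e i))).
move=> /funeqP hq; apply/funext => x; have := hq x => /=.
by have [_ _ _ ->] := qg (h x) (ldiv (g x) (f x)); have [_ -> _ _] := qg (g x) (f x).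
Qed.
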